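(* Fix a real number $\lambda>0$. There is a constant $C>0$, depending only on $\lambda$, such that for every integer $t\ge 1$ and every graph $G$ with $n\ge 2$ vertices and treewidth at most $t$, the hardcore Glauber dynamics on $G$ with parameter $\lambda$ has mixing time $\tau(1/4)\le n^{Ct}$. (That is, the hardcore Glauber dynamics mixes in time $n^{O(t)}$ on graphs of treewidth $t$, for every fixed $\lambda>0$.)
   Context: The hardcore Glauber dynamics on a graph $G$ with parameter $\lambda>0$ is the Markov chain on the independent sets of $G$: start from an arbitrary independent set $X_0$; at each step $t\ge 0$ choose a vertex $v\in V(G)$ uniformly at random; if $v\notin X_t$ and $X_t\cup\{v\}$ is not independent, set $X_{t+1}=X_t$; otherwise set $X_{t+1}=X_t\cup\{v\}$ with probability $\lambda/(\lambda+1)$ and $X_{t+1}=X_t\setminus\{v\}$ with probability $1/(\lambda+1)$. Its stationary distribution is $\pi^*(S)=\lambda^{|S|}/Z$ with $Z$ the normalizing constant. The mixing time $\tau(\varepsilon)$ of a Markov chain with state space $\Omega$ and stationary distribution $\pi^*$ is the minimum time $t$ such that for every starting state, the distribution $\pi_t$ of the chain at time $t$ satisfies $\frac12\sum_{S\in\Omega}|\pi_t(S)-\pi^*(S)|<\varepsilon$. Treewidth is the usual (Robertson–Seymour) treewidth. *)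

(* Defs.v *)
From HB Require Import structures.
From mathcomp Require Import all_boot all_order all_algebra.
From mathcomp Require Import all_classical all_reals all_analysis.
Set Implicit Arguments.
Unset Strict Implicit.
Unset Printing Implicit Defensive.
Import Order.TTheory GRing.Theory Num.Theory.
Local Open Scope ring_scope.

(** Finite simple graphs and trees *)

Record sgraph := SGraph {
  vertex :> finType;
  edge : rel vertex;
  edge_sym : symmetric edge;
  edge_irr : irreflexive edge }.

Definition is_tree (T : sgraph) : Prop :=
  [/\ (0 < #|T|)%N,
      forall x y : T, connect (@edge T) x y
    & forall c : seq T, (2 < size c)%N -> ~ ucycle (@edge T) c].

(** Treewidth *)

Record is_tree_decomposition (G T : sgraph) (B : T -> {set G}) : Prop := {
  td_tree : is_tree T;
  td_vertex : forall v : G, exists i : T, v \in B i;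
  td_edge : forall u v : G, edge u v -> exists i : T, u \in B i /\ v \in B i;
  td_connected : forall (v : G) (i j : T), v \in B i -> v \in B j ->
    connect [rel x y : T | [&& edge x y, v \in B x & v \in B y]] i j }.

(* The truncated predecessor differs from the integer [max - 1] only for the
   graph with no vertex. *)
Definition td_width (G T : sgraph) (B : T -> {set G}) : nat :=
  (\max_(i : T) #|B i|).-1.

Definition has_width (G : sgraph) (k : nat) : Prop :=
  exists (T : sgraph) (B : T -> {set G}),
    is_tree_decomposition B /\ td_width B = k.

Lemma has_width_ex (G : sgraph) : exists k : nat, `[< has_width G k >].
Proof.
pose T := @SGraph unit (fun _ _ => false) (fun _ _ => erefl) (fun _ => erefl).
pose B (_ : T) : {set G} := [set: G]%SET.
exists (td_width B); apply/asboolP; exists T, B; split=> //.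
split.
- split; first by rewrite card_unit.
  + by move=> [] []; exact: connect0.
  + by move=> [|[] [|[] c]].
- by move=> v; exists tt; rewrite inE.
- by move=> u v _; exists tt; rewrite !inE.
- by move=> v [] [] _ _; exact: connect0.
Qed.

Definition treewidth (G : sgraph) : nat := ex_minn (has_width_ex G).

(** Mixing time of a finite Markov chain *)

Section MarkovChain.
Context {R : realType} {Omega : finType}.
Implicit Types (P : Omega -> Omega -> R) (pi : Omega -> R) (x y : Omega).

Fixpoint chain_law P x (t : nat) (y : Omega) : R :=
  if t is t'.+1 then \sum_(z : Omega) chain_law P x t' z * P z y
  else (y == x)%:R.

Definition tv_dist (mu nu : Omega -> R) : R :=
  2^-1 * \sum_(y : Omega) `|mu y - nu y|.

Definition mixed_at P pi (eps : R) (t : nat) : Prop :=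
  forall x, tv_dist (chain_law P x t) pi < eps.

(* As an infimum in [\bar R], this is the least such [t], and [+oo] if there is
   none. *)
Definition mixing_time P pi (eps : R) : \bar R :=
  ereal_inf [set (t%:R)%:E | t in [set t : nat | mixed_at P pi eps t]].

End MarkovChain.

(** Hardcore Glauber dynamics *)

Definition independent (G : sgraph) (S : {set G}) : bool :=
  [forall u in S, forall v in S, ~~ edge u v].

Record indset (G : sgraph) := IndSet {
  indset_val :> {set G};
  _ : independent indset_val }.

HB.instance Definition _ (G : sgraph) := [isSub for @indset_val G].
HB.instance Definition _ (G : sgraph) := [Finite of indset G by <:].

Section Glauber.
Context {R : realType} {G : sgraph}.
Implicit Types (lam : R) (S : indset G).

(* Probability that the chain moves from [S] to [S'] once [v] is selected. *)
Definition glauber_update lam (v : G) S S' : R :=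
  if (v \notin (S : {set G})) && ~~ independent (v |: S) then (S' == S)%:R
  else lam / (lam + 1) * (S' == v |: S :> {set G})%:R
       + 1 / (lam + 1) * (S' == S :\ v :> {set G})%:R.

Definition glauber lam S S' : R :=
  \sum_(v : G) (#|G|%:R)^-1 * glauber_update lam v S S'.

Definition hardcore lam S : R :=
  lam ^+ #|S| / \sum_(S' : indset G) lam ^+ #|S'|.

End Glauber.

(* Main.v *)
(** The Glauber chain satisfies a Poincare inequality whose constant is
    exponential in the tree-depth.  For two vertex sets with no edge between
    them, the hardcore measure on their union is a product, and the constant
    does not grow.  Adding a vertex [v] to [W] costs a factor [1 + 2 lam]: an
    independent set [S] containing [v] is compared with [S :\ v], and the law of
    [S :\ v] is dominated by [lam] times the unnormalised measure on [W].
    A tree decomposition of width [t] has a bag of at most [t + 1] vertices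
    splitting any [W] into pieces of at most half its size, so that recursing
    [O(log n)] times gives the constant [(1 + 2 lam) ^ O(t log n) = n ^ O(t)].
    As each state is kept with probability bounded below, the Poincare
    inequality gives geometric decay of the variance of the density of the law
    of the chain, and the least stationary probability is only exponentially
    small in [n]. *)

Require Import Defs.
From HB Require Import structures.
From mathcomp Require Import all_boot all_order all_algebra.
From mathcomp Require Import all_classical all_reals all_analysis.
From mathcomp Require Import ring lra zify.
Set Implicit Arguments.
Unset Strict Implicit.
Unset Printing Implicit Defensive.
Import Order.TTheory GRing.Theory Num.Theory.
Local Open Scope ring_scope.

(** * Weighted variance and the Poincare inequality for the hardcore measure *)

(** Lagrange's identity: twice the difference of the two sides is the double sum of
    [w i * w j * (g i - g j) ^+ 2]. *)
Lemma sum_CauchySchwarz (R : realFieldType) (I : finType) (p : pred I)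
    (w g : I -> R) : (forall i, p i -> 0 <= w i) ->
  (\sum_(i | p i) w i * g i) ^+ 2 <=
  (\sum_(i | p i) w i) * (\sum_(i | p i) w i * g i ^+ 2).
Proof.
move=> w0.
have key : 0 <= \sum_(i | p i) \sum_(j | p j) w i * w j * (g i - g j) ^+ 2.
  apply: sumr_ge0 => i pi; apply: sumr_ge0 => j pj.
  by rewrite mulr_ge0 ?sqr_ge0 // mulr_ge0 ?w0.
suff E : \sum_(i | p i) \sum_(j | p j) w i * w j * (g i - g j) ^+ 2 =
  2 * ((\sum_(i | p i) w i) * (\sum_(i | p i) w i * g i ^+ 2) -
       (\sum_(i | p i) w i * g i) ^+ 2) by rewrite E in key; lra.
have -> : \sum_(i | p i) \sum_(j | p j) w i * w j * (g i - g j) ^+ 2 =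
  \sum_(i | p i) \sum_(j | p j) (w i * g i ^+ 2) * w j +
  \sum_(i | p i) \sum_(j | p j) w i * (w j * g j ^+ 2) -
  2 * \sum_(i | p i) \sum_(j | p j) (w i * g i) * (w j * g j).
  rewrite mulr_sumr -big_split -sumrB; apply: eq_bigr => i _ /=.
  rewrite mulr_sumr -big_split -sumrB; apply: eq_bigr => j _ /=.
  ring.
rewrite -!big_distrlr /=; ring.
Qed.

Lemma ler_sum_sub (R : numDomainType) (I : finType) (p q : pred I) (F : I -> R) :
  (forall i, p i -> q i) -> (forall i, q i -> 0 <= F i) ->
  \sum_(i | p i) F i <= \sum_(i | q i) F i.
Proof.
move=> pq F0; rewrite [leRHS](bigID p) /=.
rewrite [X in _ <= X + _](eq_bigl p); last first.
  by move=> i /=; case pi: (p i); rewrite ?andbF // pq.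
by rewrite lerDl sumr_ge0 // => i /andP[/F0].
Qed.

Section WeightedMean.
Context {R : realFieldType} {I : finType} (p : pred I) (w : I -> R).
Hypothesis w_ge0 : forall i, p i -> 0 <= w i.
Hypothesis w_sum_gt0 : 0 < \sum_(i | p i) w i.

Definition wmean (f : I -> R) := (\sum_(i | p i) w i * f i) / \sum_(i | p i) w i.

(** Not divided by the total weight, to match the equally unnormalised [hc_form]; for a probability
    weight this is the usual variance. *)
Definition wvar (f : I -> R) := \sum_(i | p i) w i * (f i - wmean f) ^+ 2.

Lemma sum_wmean f :
  (\sum_(i | p i) w i) * wmean f = \sum_(i | p i) w i * f i.
Proof. by rewrite mulrC divfK ?gt_eqF. Qed.

Lemma sum_sqrB_wvar f (m : R) :
  \sum_(i | p i) w i * (f i - m) ^+ 2 =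
  wvar f + (\sum_(i | p i) w i) * (wmean f - m) ^+ 2.
Proof.
have E c : \sum_(i | p i) w i * (f i - c) ^+ 2 =
    \sum_(i | p i) w i * f i ^+ 2 - 2 * c * (\sum_(i | p i) w i * f i)
    + (\sum_(i | p i) w i) * c ^+ 2.
  rewrite mulr_sumr mulr_suml -sumrB -big_split; apply: eq_bigr => i _ /=.
  ring.
rewrite /wvar !E -!sum_wmean; ring.
Qed.

(** The mean is the best centre, so an upper bound on a variance may use any convenient one, such as
    a mean over a smaller vertex set. *)
Lemma wvar_le f (m : R) : wvar f <= \sum_(i | p i) w i * (f i - m) ^+ 2.
Proof.
by rewrite sum_sqrB_wvar lerDl mulr_ge0 ?sqr_ge0 // sumr_ge0.
Qed.

End WeightedMean.

Section HardcorePoincare.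
Context {R : realFieldType} (lam : R) (lam_gt0 : 0 < lam) (G : sgraph).
Implicit Types (W S : {set G}) (v : G) (f : {set G} -> R).

Definition ind_in W S : bool := independent S && (S \subset W).

Definition hc_weight S : R := lam ^+ #|S|.

(** Unnormalised Dirichlet form of the single-vertex moves: each pair [S], [S :\ v] is counted once,
    with the weight of its larger set. *)
Definition hc_form W f : R :=
  \sum_(v in W) \sum_(S | ind_in W S && (v \in S))
     hc_weight S * (f S - f (S :\ v)) ^+ 2.

Definition poincare (c : R) W : Prop :=
  forall f, wvar (ind_in W) hc_weight f <= c * hc_form W f.

Lemma hc_weight_ge0 S : 0 <= hc_weight S.
Proof. exact/exprn_ge0/ltW. Qed.

Lemma hc_form_ge0 W f : 0 <= hc_form W f.
Proof.
apply: sumr_ge0 => v _; apply: sumr_ge0 => S _.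
by rewrite mulr_ge0 ?hc_weight_ge0 ?sqr_ge0.
Qed.

Lemma independent0 : independent (finset.set0 : {set G}).
Proof. by apply/forall_inP => u; rewrite inE. Qed.

Lemma independentS (S S' : {set G}) :
  S' \subset S -> independent S -> independent S'.
Proof.
move=> /fintype.subsetP sub /forall_inP ind; apply/forall_inP => u uS'.
apply/forall_inP => v vS'.
by have /forall_inP := ind _ (sub _ uS'); apply; apply: sub.
Qed.

Lemma hc_partition_gt0 W : 0 < \sum_(S | ind_in W S) hc_weight S.
Proof.
rewrite (bigD1 finset.set0); last by rewrite /ind_in independent0 finset.sub0set.
rewrite ltr_wpDr ?exprn_gt0 // sumr_ge0 // => S _; exact: hc_weight_ge0.
Qed.

Lemma poincareW (c c' : R) W : c <= c' -> poincare c W -> poincare c' W.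
Proof.
move=> cc' pc f; apply: le_trans (pc f) _.
by rewrite ler_wpM2r ?hc_form_ge0.
Qed.

Lemma poincare0 (c : R) : 0 <= c -> poincare c finset.set0.
Proof.
move=> c0 f; apply: le_trans (_ : 0 <= _); last first.
  by rewrite mulr_ge0 ?hc_form_ge0.
have E : ind_in finset.set0 =1 pred1 (finset.set0 : {set G}).
  move=> S; rewrite /ind_in finset.subset0 /=; case: eqP => [->|]; rewrite ?andbF //.
  by rewrite independent0.
rewrite /wvar /wmean !(eq_bigl _ _ E) !big_pred1_eq.
by rewrite /hc_weight cards0 expr0 !mul1r divr1 subrr expr0n.
Qed.

(** All squares are centred at the mean [m] over [W]. Sets avoiding [v] contribute the variance [V]
    on [W]; sets containing [v] are compared with [S :\ v] and contribute at most
    [2 * dv + 2 * (lam * V)]. The hypothesis [2 <= c] absorbs the coefficient of [dv]. *)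
Lemma poincareU1 (c : R) W v : 2 <= c -> v \notin W ->
  poincare c W -> poincare ((1 + 2 * lam) * c) (v |: W).
Proof.
move=> c2 vW pc f.
set m := wmean (ind_in W) hc_weight f.
apply: le_trans (wvar_le _ (hc_partition_gt0 _) f m) _.
  by move=> *; exact: hc_weight_ge0.
set dv := \sum_(S | ind_in (v |: W) S && (v \in S))
     hc_weight S * (f S - f (S :\ v)) ^+ 2.
have notin S : (S \subset v |: W) && (v \notin S) = (S \subset W).
  apply/idP/idP => [/andP[/fintype.subsetP sub vS]|sub].
    apply/fintype.subsetP => x xS; have := sub _ xS; rewrite !inE.
    by case/orP => // /eqP xv; rewrite -xv xS in vS.
  rewrite (fintype.subset_trans sub) ?finset.subsetUr //=.
  by apply: contra vW; apply: (fintype.subsetP sub).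
have dform : dv + hc_form W f <= hc_form (v |: W) f.
  rewrite {2}/hc_form big_setU1 //= lerD2l; apply: ler_sum => u uW.
  apply: ler_sum_sub => [S /andP[/andP[ind sub] uS]|S _].
    by rewrite /ind_in ind uS andbT (fintype.subset_trans sub) ?finset.subsetUr.
  by rewrite mulr_ge0 ?hc_weight_ge0 ?sqr_ge0.
set V := wvar (ind_in W) hc_weight f.
have bound : \sum_(S | ind_in (v |: W) S && (v \in S))
    hc_weight S * (f (S :\ v) - m) ^+ 2 <= lam * V.
  (* Reindexing by [S :\ v] extracts one factor [lam]; the sum is then enlarged to all independent
     subsets of [W]. *)
  rewrite mulr_sumr (reindex_onto (fun S => v |: S) (fun S => S :\ v)) /=;
    last first.
    by move=> S /andP[_ vS]; rewrite finset.setD1K.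
  apply: le_trans (_ : \sum_(S | [&& ind_in (v |: W) (v |: S), v \in v |: S &
      (v |: S) :\ v == S]) lam * (hc_weight S * (f S - m) ^+ 2) <= _).
    rewrite le_eqVlt; apply/orP; left; apply/eqP.
    apply: eq_big => [S|S /andP[_ /eqP E]]; first by rewrite andbA.
    have vS : v \notin S by rewrite -E setD11.
    by rewrite E /hc_weight cardsU1 vS add1n exprS mulrA.
  apply: ler_sum_sub => [S /and3P[/andP[ind sub] _ /eqP E]|S _].
    have vS : v \notin S by rewrite -E setD11.
    rewrite /ind_in (independentS _ ind) ?finset.subsetUr // -notin vS andbT.
    by apply: fintype.subset_trans sub; rewrite finset.subsetUr.
  by rewrite mulr_ge0 ?(ltW lam_gt0) // mulr_ge0 ?hc_weight_ge0 ?sqr_ge0.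
rewrite (bigID (fun S : {set G} => v \in S)) /=.
have -> : \sum_(S | ind_in (v |: W) S && (v \notin S))
    hc_weight S * (f S - m) ^+ 2 = V.
  by apply: eq_bigl => S; rewrite /ind_in -andbA notin.
have pV : V <= c * hc_form W f by exact: pc.
have first_le : \sum_(S | ind_in (v |: W) S && (v \in S))
    hc_weight S * (f S - m) ^+ 2 <= 2 * dv + 2 * (lam * V).
  apply: le_trans (_ : 2 * dv + 2 * (\sum_(S | ind_in (v |: W) S && (v \in S))
    hc_weight S * (f (S :\ v) - m) ^+ 2) <= _); last first.
    by rewrite lerD2l ler_pM2l.
  rewrite !mulr_sumr -big_split; apply: ler_sum => S _ /=.
  (* With [a = f S - f (S :\ v)] and [b = f (S :\ v) - m], the square is [(a - b) ^+ 2], which is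
     [2 * a ^+ 2 + 2 * b ^+ 2 - (a + b) ^+ 2]. *)
  have := mulr_ge0 (hc_weight_ge0 S) (sqr_ge0 (f S - 2 * f (S :\ v) + m)).
  rewrite !expr2; lra.
have dv0 : 0 <= dv.
  by apply: sumr_ge0 => S _; rewrite mulr_ge0 ?hc_weight_ge0 ?sqr_ge0.
have h0 := hc_form_ge0 W f.
have c2' : 2 <= (1 + 2 * lam) * c.
  have : 0 <= lam * c by rewrite mulr_ge0 ?(ltW lam_gt0) //; lra.
  lra.
have dd : 2 * dv <= (1 + 2 * lam) * c * dv by rewrite ler_wpM2r.
have cc : (1 + 2 * lam) * c * (dv + hc_form W f) <=
    (1 + 2 * lam) * c * hc_form (v |: W) f by rewrite ler_wpM2l // (le_trans _ c2').
have l0 : 0 <= 1 + 2 * lam by have := ltW lam_gt0; lra.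
have VV : (1 + 2 * lam) * V <= (1 + 2 * lam) * (c * hc_form W f).
  exact: ler_wpM2l.
lra.
Qed.

End HardcorePoincare.

(** * Tensorisation over two vertex sets with no edge between them *)

Section HardcoreUnion.
Context {R : realFieldType} (lam : R) (lam_gt0 : 0 < lam) (G : sgraph).
Context (c : R) (c_ge0 : 0 <= c) (W1 W2 : {set G}).
Hypothesis W12 : [disjoint W1 & W2].
Hypothesis noedge : forall u v, u \in W1 -> v \in W2 -> ~~ edge u v.
Implicit Types (S : {set G}) (v : G) (f : {set G} -> R).

Local Notation w := (@hc_weight R lam G).

Lemma ind_inU (S1 S2 : {set G}) : ind_in W1 S1 -> ind_in W2 S2 ->
  ind_in (W1 :|: W2) (S1 :|: S2).
Proof.
move=> /andP[/forall_inP i1 s1] /andP[/forall_inP i2 s2].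
rewrite /ind_in finset.setUSS // andbT.
have [{}s1 {}s2] := (fintype.subsetP s1, fintype.subsetP s2).
apply/forall_inP => u /finset.setUP[] uS; apply/forall_inP => v /finset.setUP[] vS.
- exact: (forall_inP (i1 _ uS)).
- by apply: noedge; [apply: s1|apply: s2].
- by rewrite edge_sym; apply: noedge; [apply: s1|apply: s2].
- exact: (forall_inP (i2 _ uS)).
Qed.

Lemma notin_W2 v : v \in W1 -> v \notin W2.
Proof. by move=> vW; rewrite (disjointFr W12 vW). Qed.

Lemma ind_in_notin (W S : {set G}) v : v \notin W -> ind_in W S -> v \notin S.
Proof. by move=> vW /andP[_ /fintype.subsetP sub]; apply: contra vW; apply: sub. Qed.

Lemma capU1 S1 S2 : S1 \subset W1 -> S2 \subset W2 -> (S1 :|: S2) :&: W1 = S1.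
Proof.
move=> s1 s2; rewrite finset.setIUl (finset.setIidPl s1).
rewrite (disjoint_setI0 (_ : [disjoint S2 & W1])) ?finset.setU0 //.
by apply: disjointWl s2 _; rewrite disjoint_sym.
Qed.

Lemma capU2 S1 S2 : S1 \subset W1 -> S2 \subset W2 -> (S1 :|: S2) :&: W2 = S2.
Proof.
move=> s1 s2; rewrite finset.setIUl (finset.setIidPl s2).
by rewrite (disjoint_setI0 (disjointWl s1 W12)) finset.set0U.
Qed.

Lemma sum_ind_inU f : \sum_(S | ind_in (W1 :|: W2) S) f S =
  \sum_(S1 | ind_in W1 S1) \sum_(S2 | ind_in W2 S2) f (S1 :|: S2).
Proof.
rewrite pair_big /=.
rewrite (reindex_onto (fun p : {set G} * {set G} => p.1 :|: p.2)
  (fun S => (S :&: W1, S :&: W2))) /=; last first.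
  by move=> S /andP[_ sub]; rewrite -finset.setIUr (finset.setIidPl sub).
apply: eq_bigl => -[S1 S2] /=; apply/idP/idP.
  case/andP => /andP[ind _] /eqP[E1 E2].
  have s1 : S1 \subset W1 by rewrite -E1 finset.subsetIr.
  have s2 : S2 \subset W2 by rewrite -E2 finset.subsetIr.
  rewrite /ind_in s1 s2 !andbT.
  by rewrite !(independentS _ ind) ?finset.subsetUl ?finset.subsetUr.
case/andP => i1 i2; rewrite ind_inU //=.
have /andP[_ s1] := i1; have /andP[_ s2] := i2.
by rewrite capU1 ?capU2.
Qed.

Lemma hc_weightU S1 S2 : ind_in W1 S1 -> ind_in W2 S2 ->
  w (S1 :|: S2) = w S1 * w S2.
Proof.
move=> /andP[_ s1] /andP[_ s2]; rewrite /hc_weight -exprD; congr (_ ^+ _).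
rewrite cardsU (disjoint_setI0 (_ : [disjoint S1 & S2])) ?cards0 ?subn0 //.
exact: disjointW W12.
Qed.

(** A move at a vertex of one side leaves the other part of the set fixed, and the weights
    multiply. *)
Lemma hc_formU f : hc_form lam (W1 :|: W2) f =
  \sum_(S2 | ind_in W2 S2) w S2 * hc_form lam W1 (fun S1 => f (S1 :|: S2)) +
  \sum_(S1 | ind_in W1 S1) w S1 * hc_form lam W2 (fun S2 => f (S1 :|: S2)).
Proof.
rewrite {1}/hc_form (bigID (mem W1)) /=; congr (_ + _).
- under [RHS]eq_bigr do rewrite mulr_sumr.
  rewrite exchange_big; apply: eq_big => [v|v /andP[_ vW1]].
    by rewrite inE; case: (v \in W1); rewrite ?andbF.
  rewrite big_mkcondr sum_ind_inU exchange_big; apply: eq_bigr => S2 i2.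
  rewrite mulr_sumr [RHS]big_mkcondr; apply: eq_bigr => S1 i1.
  have vS2 := ind_in_notin (notin_W2 vW1) i2.
  rewrite !inE (negPf vS2) orbF; case: ifP => // _.
  rewrite hc_weightU // finset.setDUl (finset.setDidPl (_ : [disjoint S2 & [set v]])).
    ring.
  by rewrite disjoint_sym disjoints1.
- under [RHS]eq_bigr do rewrite mulr_sumr.
  rewrite exchange_big; apply: eq_big => [v|v /andP[]].
    rewrite inE; case: (boolP (v \in W1)) => [/notin_W2/negPf->|] //=.
    by rewrite andbT.
  rewrite inE => /orP[->//|vW2 vW1].
  rewrite big_mkcondr sum_ind_inU; apply: eq_bigr => S1 i1.
  rewrite mulr_sumr [RHS]big_mkcondr; apply: eq_bigr => S2 i2.
  have vS1 := ind_in_notin vW1 i1.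
  rewrite !inE (negPf vS1) /=; case: ifP => // _.
  rewrite hc_weightU // finset.setDUl (finset.setDidPl (_ : [disjoint S1 & [set v]])).
    ring.
  by rewrite disjoint_sym disjoints1.
Qed.

(** Law of total variance: the conditional variances given [S2] are controlled by [W1], the variance
    of the conditional mean [m] by [W2]. Convexity bounds the form of [m] by the average of the
    forms. *)
Lemma poincareU : poincare lam c W1 -> poincare lam c W2 ->
  poincare lam c (W1 :|: W2).
Proof.
move=> pc1 pc2 f.
have w0 S : 0 <= w S by exact: hc_weight_ge0.
pose Z1 := \sum_(S | ind_in W1 S) w S.
have Z1gt0 : 0 < Z1 by exact: hc_partition_gt0.
pose m S2 := wmean (ind_in W1) w (fun S1 => f (S1 :|: S2)).
pose M := wmean (ind_in W2) w m.
apply: le_trans (wvar_le _ (hc_partition_gt0 lam_gt0 _) f M) _ => //.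
have -> : \sum_(S | ind_in (W1 :|: W2) S) w S * (f S - M) ^+ 2 =
  \sum_(S2 | ind_in W2 S2) w S2 * wvar (ind_in W1) w (fun S1 => f (S1 :|: S2))
  + Z1 * wvar (ind_in W2) w m.
  rewrite sum_ind_inU exchange_big /= mulr_sumr -big_split.
  apply: eq_bigr => S2 i2 /=.
  rewrite mulrCA -mulrDr -sum_sqrB_wvar // mulr_sumr.
  by apply: eq_bigr => S1 i1; rewrite hc_weightU // mulrA (mulrC (w S1)).
rewrite hc_formU mulrDr lerD //.
  rewrite mulr_sumr; apply: ler_sum => S2 i2.
  by rewrite mulrCA ler_wpM2l.
apply: le_trans (_ : Z1 * (c * hc_form lam W2 m) <= _).
  by rewrite ler_pM2l.
rewrite mulrCA ler_wpM2l // /hc_form.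
under [leRHS]eq_bigr do rewrite mulr_sumr.
rewrite exchange_big mulr_sumr; apply: ler_sum => v vW2 /=.
under [leRHS]eq_bigr do rewrite mulr_sumr.
rewrite exchange_big mulr_sumr; apply: ler_sum => S2 i2 /=.
pose d S1 := f (S1 :|: S2) - f (S1 :|: (S2 :\ v)).
have -> : m S2 - m (S2 :\ v) = (\sum_(S1 | ind_in W1 S1) w S1 * d S1) / Z1.
  rewrite /m /wmean -mulrBl -sumrB; congr (_ / _).
  by apply: eq_bigr => S1 _; rewrite mulrBr.
have -> : \sum_(S1 | ind_in W1 S1) w S1 * (w S2 * d S1 ^+ 2) =
   w S2 * \sum_(S1 | ind_in W1 S1) w S1 * d S1 ^+ 2.
  by rewrite mulr_sumr; apply: eq_bigr => S1 _; rewrite mulrCA.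
rewrite mulrCA ler_wpM2l //.
(* The square of the mean of [d] is at most the mean of its square. *)
have := sum_CauchySchwarz d (fun S (_ : ind_in W1 S) => w0 S).
rewrite -/Z1 => /(ler_wpM2r (ltW (_ : 0 < Z1^-1))).
rewrite invr_gt0 => /(_ Z1gt0).
rewrite [leRHS]mulrAC divff ?gt_eqF // mul1r; apply: le_trans.
rewrite le_eqVlt; apply/orP; left; apply/eqP.
by field; rewrite gt_eqF.
Qed.

End HardcoreUnion.

(** * Balanced separators in tree decompositions *)

Section TreeSeparator.
Context (T : sgraph) (treeT : is_tree T).
Implicit Types (i j k l : T).

(** Connectivity for this relation is connectivity in the tree without node [i], which is kept as an
    isolated point so that the node type does not change. *)
Definition edge_avoiding i x y := [&& edge x y, x != i & y != i].

Lemma edge_avoiding_sym i : connect_sym (edge_avoiding i).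
Proof.
apply: sym_connect_sym => x y.
by rewrite /edge_avoiding edge_sym; congr (_ && _); rewrite andbC.
Qed.

Lemma connect_avoiding_self i k : connect (edge_avoiding i) k i -> k = i.
Proof.
rewrite edge_avoiding_sym => /connectP[[|x p]] //= /andP[/and3P[_ /eqP]].
by [].
Qed.

(** On a simple path from [i] to [k], the node after [i] is the required neighbour, and the rest of
    the path never returns to [i]. *)
Lemma connect_avoiding_edge i k : k != i ->
  exists2 j, connect (edge_avoiding i) k j & edge i j.
Proof.
move=> ki; have [_ + _] := treeT => /(_ i k) /connectP[p0 /shortenP[p + + _]].
case: p => [|j p] /=; first by move=> _ _ ki'; rewrite ki' eqxx in ki.
case/andP=> ij pj /andP[inp _] ->; exists j => //.
rewrite edge_avoiding_sym; apply/connectP; exists p => //.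
elim: p j {ij} pj inp => //= x p IH j /andP[jx px].
rewrite !inE !negb_or => /and3P[ij ix ip].
by rewrite /edge_avoiding jx (eq_sym j) ij (eq_sym x) ix IH // !inE negb_or ix.
Qed.

(** A walk inside a component of the tree without [j] that does not contain [i] never meets [i]. *)
Lemma connect_avoiding_other i j k l :
  connect (edge_avoiding j) k l -> ~~ connect (edge_avoiding j) k i ->
  connect (edge_avoiding i) k l.
Proof.
move=> /connectP[p + ->] {l} ki; elim: p k ki => [|x p IH] k ki //=.
case/andP=> kx px.
have xi : ~~ connect (edge_avoiding j) x i.
  by apply: contra ki; apply: connect_trans; apply: connect1.
have ne y : ~~ connect (edge_avoiding j) y i -> y != i.
  by apply: contraNneq => ->; apply: connect0.
apply: connect_trans (IH _ xi px); apply: connect1.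
by have /and3P[kx' _ _] := kx; rewrite /edge_avoiding kx' !ne.
Qed.

(** Neither connection uses the edge between [i] and [j], so together they link [j] to [i] without
    it; a simple such path closes up with that edge to a cycle. *)
Lemma tree_edge_bridge i j l : edge i j ->
  connect (edge_avoiding i) j l -> connect (edge_avoiding j) i l -> False.
Proof.
move=> ij jl il.
pose e' := [rel x y : T | edge x y &&
  ~~ ((x == i) && (y == j) || (x == j) && (y == i))].
have e'_sym : connect_sym e'.
  apply: sym_connect_sym => x y /=.
  by rewrite edge_sym; congr (_ && ~~ _); rewrite orbC andbC [X in _ || X]andbC.
have ji : connect e' j i.
  apply: (@connect_trans _ _ l).
    apply: connect_sub jl => x y /and3P[xy xi yi]; apply: connect1.
    by rewrite /= xy (negPf xi) (negPf yi) andbF.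
  rewrite e'_sym; apply: connect_sub il => x y /and3P[xy xi yi].
  by apply: connect1; rewrite /= xy (negPf xi) (negPf yi) andbF.
have [_ _ acyclic] := treeT.
have /connectP[p0 /shortenP[p pp up _] ip] := ji.
apply: (acyclic (j :: p)).
  (* Cycles need more than two nodes: an empty path would give [i = j], and a path of one step would
     be the edge excluded from [e']. *)
  case: p pp up ip => [|x [|y p]] //=.
    by move=> _ _ ij'; rewrite ij' edge_irr in ij.
  by move=> /andP[/andP[_ h] _] _ ix; rewrite -ix !eqxx orbT in h.
apply/andP; split=> //=; rewrite rcons_path -ip ij andbT.
by apply: sub_path pp => x y /andP[].
Qed.

Context (G : sgraph) (B : T -> {set G}) (tdB : is_tree_decomposition B).
Context (W : {set G}).

(** The nodes whose bags contain [v] are connected among themselves, and [i] is not one of them. *)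
Lemma connect_avoiding_bag i k l (v : G) :
  v \notin B i -> v \in B k -> v \in B l -> connect (edge_avoiding i) k l.
Proof.
move=> vi vk vl; apply: connect_sub (td_connected tdB vk vl) => x y.
case/and3P=> xy vx vy; apply: connect1.
rewrite /edge_avoiding xy /=; apply/andP; split.
  by apply: contraNneq vi => <-.
by apply: contraNneq vi => <-.
Qed.

(** The component of the tree without [i] is named by any of its nodes [k]. *)
Definition branch i k : {set G} :=
  [set v in W | (v \notin B i) &&
     [exists l, connect (edge_avoiding i) k l && (v \in B l)]].

(** If every node had a branch with more than half of [W], take such a pair [i], [k] whose component
    has the fewest nodes and step to the neighbour [j] of [i] in it. The heavy branch at [j] either
    points back to [i] or lies in a smaller component; both are impossible. *)
Lemma light_branches :
  exists i, forall k, k != i -> (2 * #|branch i k| <= #|W|)%N.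
Proof.
pose heavy i k := (k != i) && (#|W| < 2 * #|branch i k|)%N.
suff: ~ forall i, exists k, heavy i k.
  move=> H; have [[i Hi]|nex] := pselect (exists i, ~ exists k, heavy i k).
    exists i => k ki; rewrite leqNgt; apply/negP => hk.
    by apply: Hi; exists k; rewrite /heavy ki hk.
  exfalso; apply: H => i; apply: contrapT => Hi; apply: nex.
  by exists i.
move=> allheavy.
have exn : exists n, [exists i, [exists k,
    heavy i k && (#|[set l | connect (edge_avoiding i) k l]| == n)]].
  have [/card_gt0P[i _] _ _] := treeT; have [k hk] := allheavy i.
  exists #|[set l | connect (edge_avoiding i) k l]|.
  by apply/existsP; exists i; apply/existsP; exists k; rewrite hk eqxx.
case: (ex_minnP exn) => n /existsP[i /existsP[k /andP[/andP[ki hik] /eqP nE]]] min.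
have [j kj ij] := connect_avoiding_edge ki.
have [k2 /andP[k2j hjk2]] := allheavy j.
have ji : j != i by apply: contraTneq ij => ->; rewrite edge_irr.
(* Pointing back to [i]: a vertex common to both branches would contradict [tree_edge_bridge], so
   two disjoint subsets would each hold more than half of [W]. *)
have [k2i|k2i] := boolP (connect (edge_avoiding j) k2 i).
  have dis : [disjoint branch i k & branch j k2].
    rewrite -setI_eq0; apply/eqP/finset.setP => v; rewrite !inE.
    apply/negP => /andP[/and3P[_ vi /existsP[l /andP[kl vl]]]].
    case/and3P=> _ vj /existsP[l' /andP[k2l' vl']].
    apply: (tree_edge_bridge ij (l := l')).
      rewrite edge_avoiding_sym in kj; apply: connect_trans kj _.
      exact: connect_trans kl (connect_avoiding_bag vi vl vl').
    by rewrite edge_avoiding_sym in k2i; apply: connect_trans k2i _.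
  have sub : branch i k :|: branch j k2 \subset W.
    by apply/fintype.subsetP => v; rewrite !inE => /orP[] /andP[].
  have := subset_leq_card sub; rewrite cardsU (disjoint_setI0 dis) cards0.
  lia.
(* Pointing away from [i]: the new component is contained in the old one and misses [j], against
   minimality. *)
have [y k2y jy] := connect_avoiding_edge k2j.
have ne : y != i by apply: contraNneq k2i => <-.
have k2j' : connect (edge_avoiding i) k2 j.
  apply: connect_trans (connect_avoiding_other k2y k2i) (connect1 _).
  by rewrite /edge_avoiding edge_sym jy ne ji.
have lt : [set l | connect (edge_avoiding j) k2 l] \proper
    [set l | connect (edge_avoiding i) k l].
  apply/properP; split.
    apply/fintype.subsetP => l; rewrite !inE => k2l.
    apply: connect_trans kj _; rewrite edge_avoiding_sym in k2j'.
    apply: connect_trans k2j' _; exact: connect_avoiding_other k2l k2i.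
  exists j; rewrite !inE //; apply/negP => /connect_avoiding_self E.
  by rewrite E eqxx in k2j.
have := proper_card lt; rewrite nE ltnNge min //.
apply/existsP; exists j; apply/existsP; exists k2.
by rewrite /heavy k2j hjk2 eqxx.
Qed.

(** Each vertex is labelled by the component of the tree without [i] that contains a chosen node
    [b v] with [v] in its bag. Adjacent vertices outside [B i] share a bag, hence a label, and each
    class lies in one light branch. *)
Lemma tree_separator : exists i (phi : G -> {set T}),
  (forall u v, u \notin B i -> v \notin B i -> edge u v -> phi u = phi v) /\
  forall x, (2 * #|[set v in W :\: B i | phi v == x]| <= #|W|)%N.
Proof.
have [i light] := light_branches.
have [b bP] := boolp.choice (td_vertex tdB).
exists i, (fun v => [set l | connect (edge_avoiding i) (b v) l]); split.
  move=> u v ui vi /(td_edge tdB)[k [uk vk]]; apply/finset.setP => l.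
  rewrite !inE; apply: same_connect; first exact: edge_avoiding_sym.
  apply: connect_trans (connect_avoiding_bag ui (bP u) uk) _.
  exact: connect_avoiding_bag vi vk (bP v).
move=> x; set F := finset _.
have [->|[u uF]] := set_0Vmem F; first by rewrite cards0.
have := uF; rewrite !inE => /andP[/andP[ui uW] /eqP ux].
apply: leq_trans (light (b u) _); last by apply: contraNneq ui => <-.
rewrite leq_pmul2l //; apply: subset_leq_card.
apply/fintype.subsetP => v; rewrite !inE => /andP[/andP[vi vW] /eqP vx].
rewrite vW vi; apply/existsP; exists (b v); rewrite bP andbT.
have : b v \in [set l | connect (edge_avoiding i) (b v) l] by rewrite inE connect0.
by rewrite vx -ux inE.
Qed.

End TreeSeparator.

(** * The Poincare inequality from a tree decomposition *)

Section TreewidthPoincare.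
Context {R : realFieldType} (lam : R) (lam_gt0 : 0 < lam) (G : sgraph).
Implicit Types (W : {set G}) (c : R).

(** Distinct fibres have no edges between them, so they are merged one at a time by [poincareU]
    without loss in the constant. *)
Lemma poincare_fibers (X : finType) (phi : G -> X) c W : 0 <= c ->
  (forall u v, u \in W -> v \in W -> edge u v -> phi u = phi v) ->
  (forall x, poincare lam c [set v in W | phi v == x]) -> poincare lam c W.
Proof.
move=> c0 phiE pc.
suff H (s : seq X) : uniq s -> poincare lam c [set v in W | phi v \in s].
  have -> : W = [set v in W | phi v \in enum X].
    by apply/finset.setP => v; rewrite inE mem_enum andbT.
  exact/H/enum_uniq.
elim: s => [_|x s IH /= /andP[xs us]].
  have -> : [set v in W | phi v \in [::]] = finset.set0.
    by apply/finset.setP => v; rewrite !inE andbF.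
  exact: poincare0.
have -> : [set v in W | phi v \in x :: s] =
    [set v in W | phi v == x] :|: [set v in W | phi v \in s].
  by apply/finset.setP => v; rewrite !inE -andb_orr.
apply: poincareU => //; last exact: IH.
  rewrite -setI_eq0; apply/eqP/finset.setP => v; rewrite !inE.
  apply/negP => /andP[/andP[_ /eqP vx] /andP[_]]; rewrite vx.
  exact/negP.
move=> u v; rewrite !inE => /andP[uW /eqP ux] /andP[vW vs].
by apply: contra xs => uv; rewrite -ux (phiE u v).
Qed.

Lemma poincareU_set c (A W : {set G}) : 2 <= c -> [disjoint A & W] ->
  poincare lam c W -> poincare lam ((1 + 2 * lam) ^+ #|A| * c) (A :|: W).
Proof.
have l1 : 1 <= 1 + 2 * lam by have := lam_gt0; lra.
move=> c2 + pc; have [n] := ubnP #|A|.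
elim: n A => // n IH A An dis.
have [->|[v vA]] := set_0Vmem A; first by rewrite cards0 expr0 mul1r finset.set0U.
have := finset.setD1K vA; set A' := A :\ v => AE.
have vA' : v \notin A' by rewrite setD11.
have cA : #|A| = #|A'|.+1 by rewrite (cardsD1 v) vA.
rewrite cA exprS -mulrA -AE -finset.setUA; apply: poincareU1 => //.
- rewrite -[leLHS]mul1r ler_pM // ?exprn_ege1 //.
- by rewrite inE negb_or vA' (disjointFr dis vA).
- apply: IH; first by rewrite -ltnS -cA.
  by apply: disjointWl dis; rewrite -AE finset.subsetUr.
Qed.

(** Induction on the depth [k]: deleting a separating bag at least halves the size bound, and
    putting its vertices back costs at most [(1 + 2 * lam) ^+ b]. At depth [0] the set is empty. *)
Lemma poincare_tree_decomposition (T : sgraph) (B : T -> {set G}) (b k : nat) W :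
  is_tree_decomposition B -> (forall i, #|B i| <= b)%N -> (#|W| < 2 ^ k)%N ->
  poincare lam (2 * (1 + 2 * lam) ^+ (k * b)) W.
Proof.
have l1 : 1 <= 1 + 2 * lam by have := lam_gt0; lra.
move=> tdB Bb; elim: k W => [|k IH] W Wk.
  have -> : W = finset.set0 by apply/eqP; rewrite -cards_eq0; lia.
  by apply: poincare0 => //; rewrite mulr_ge0 // exprn_ge0 // (le_trans ler01).
have [i [phi [phiE small]]] := tree_separator (td_tree tdB) tdB W.
have c2 : 2 <= 2 * (1 + 2 * lam) ^+ (k * b).
  by rewrite -[leLHS]mulr1 ler_pM2l // exprn_ege1.
have pcD : poincare lam (2 * (1 + 2 * lam) ^+ (k * b)) (W :\: B i).
  apply: (@poincare_fibers _ phi); first exact: le_trans c2.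
    by move=> u v /setDP[_ ui] /setDP[_ vi]; apply: phiE.
  move=> x; apply: IH; rewrite -(ltn_pmul2l (m := 2)) // -expnS.
  exact: leq_ltn_trans (small x) Wk.
rewrite -(finset.setID W (B i)).
apply: poincareW (poincareU_set c2 _ pcD) => //.
  rewrite mulrCA ler_pM2l // -exprD ler_weXn2l // mulSn leq_add2r.
  by apply: leq_trans (Bb i); apply: subset_leq_card; rewrite finset.subsetIr.
by rewrite -setI_eq0; apply/eqP/finset.setP => v; rewrite !inE;
  case: (v \in B i); rewrite ?andbF.
Qed.

End TreewidthPoincare.

(** * Mixing of reversible chains *)

Section ReversibleChain.
Context {R : realType} {Omega : finType}.
Context (P : Omega -> Omega -> R) (pi : Omega -> R) (delta kappa : R).
Hypothesis P_ge0 : forall x y, 0 <= P x y.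
Hypothesis P_sum1 : forall x, \sum_y P x y = 1.
Hypothesis pi_gt0 : forall x, 0 < pi x.
Hypothesis pi_sum1 : \sum_x pi x = 1.
Hypothesis reversible : forall x y, pi x * P x y = pi y * P y x.
Hypothesis lazy : forall x, delta <= P x x.
Hypothesis delta_ge0 : 0 <= delta.
Hypothesis kappa_gt0 : 0 < kappa.
Hypothesis delta_kappa : delta <= kappa.
Hypothesis gap : forall f, wvar predT pi f <=
  kappa * \sum_x \sum_y pi x * P x y * (f y - f x) ^+ 2.

Definition chain_op (f : Omega -> R) x := \sum_y P x y * f y.

Lemma stationary_sum f : \sum_x pi x * chain_op f x = \sum_x pi x * f x.
Proof.
under eq_bigr do rewrite mulr_sumr.
rewrite exchange_big; apply: eq_bigr => y _ /=.
under eq_bigr do rewrite mulrA reversible -mulrA mulrCA.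
by rewrite -mulr_suml P_sum1 mul1r.
Qed.

(** Let [D] be the sum on the left. The shift of the mean from [f x] only involves [y != x], of mass
    [1 - P x x], so by Cauchy-Schwarz its square is at most [(1 - P x x) * D]; the variance is [D]
    minus that square. *)
Lemma lazy_variance f x : P x x * (\sum_y P x y * (f y - f x) ^+ 2) <=
  wvar predT (P x) f.
Proof.
have sum_gt0 : 0 < \sum_y P x y by rewrite P_sum1.
have mE : wmean predT (P x) f - f x =
    \sum_(y | y != x) P x y * (f y - f x).
  transitivity (\sum_y P x y * (f y - f x)).
    under [RHS]eq_bigr do rewrite mulrBr.
    by rewrite sumrB -mulr_suml /wmean P_sum1 divr1 mul1r.
  by rewrite (bigD1 x) //= subrr mulr0 add0r.
have off_diag (F : Omega -> R) : \sum_y F y * (f y - f x) ^+ 2 =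
    \sum_(y | y != x) F y * (f y - f x) ^+ 2.
  by rewrite (bigD1 x) //= subrr expr0n mulr0 add0r.
have CS := sum_CauchySchwarz (fun y => f y - f x)
  (fun y (_ : y != x) => P_ge0 x y).
have := sum_sqrB_wvar sum_gt0 f (f x); rewrite P_sum1 mul1r mE => E.
have P1 : \sum_(y | y != x) P x y = 1 - P x x.
  by rewrite -(P_sum1 x) [in RHS](bigD1 x) //= addrAC subrr add0r.
by rewrite P1 -off_diag in CS; lra.
Qed.

Lemma chain_op_sqr f x m : (chain_op f x - m) ^+ 2 <=
  \sum_y P x y * (f y - m) ^+ 2 - delta * \sum_y P x y * (f y - f x) ^+ 2.
Proof.
have sum_gt0 : 0 < \sum_y P x y by rewrite P_sum1.
have E := sum_sqrB_wvar sum_gt0 f m.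
have mE : wmean predT (P x) f = chain_op f x by rewrite /wmean P_sum1 divr1.
rewrite E mE P_sum1 mul1r.
have D0 : 0 <= \sum_y P x y * (f y - f x) ^+ 2.
  by apply: sumr_ge0 => y _; rewrite mulr_ge0 ?sqr_ge0.
have := lazy_variance f x; have := ler_wpM2r D0 (lazy x); lra.
Qed.

(** Averaging [chain_op_sqr] over [pi], the first term returns the variance by stationarity and the
    second is [delta] times the Dirichlet form, bounded below by [gap]. Laziness thus replaces any
    control of negative eigenvalues. *)
Lemma wvar_chain_op f :
  wvar predT pi (chain_op f) <= (1 - delta / kappa) * wvar predT pi f.
Proof.
have mE : wmean predT pi (chain_op f) = wmean predT pi f.
  by rewrite /wmean stationary_sum.
set m := wmean predT pi f in mE.
have step : wvar predT pi (chain_op f) <= wvar predT pi f -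
    delta * \sum_x \sum_y pi x * P x y * (f y - f x) ^+ 2.
  rewrite {1}/wvar mE.
  have -> : wvar predT pi f = \sum_x pi x * \sum_y P x y * (f y - m) ^+ 2.
    by rewrite (stationary_sum (fun y => (f y - m) ^+ 2)).
  rewrite mulr_sumr -sumrB; apply: ler_sum => x _.
  have -> : \sum_y pi x * P x y * (f y - f x) ^+ 2 =
      pi x * \sum_y P x y * (f y - f x) ^+ 2.
    by rewrite mulr_sumr; apply: eq_bigr => y _; rewrite mulrA.
  by rewrite [X in _ <= _ - X]mulrCA -mulrBr ler_pM2l ?chain_op_sqr.
apply: le_trans step _.
have := ler_wpM2l delta_ge0 (gap f).
rewrite -(ler_pM2l (_ : 0 < kappa^-1)) ?invr_gt0 //.
rewrite [X in _ <= X -> _]mulrCA mulKf ?gt_eqF // mulrBl mul1r.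
rewrite [delta / kappa]mulrC -mulrA; lra.
Qed.

(** By reversibility the operator is self-adjoint for [pi], so it also drives the density of the
    law. *)
Lemma chain_law_density x t y :
  chain_law P x t.+1 y / pi y =
  chain_op (fun z => chain_law P x t z / pi z) y.
Proof.
rewrite /= mulr_suml; apply: eq_bigr => z _.
have := reversible y z; have := gt_eqF (pi_gt0 y); have := gt_eqF (pi_gt0 z).
move=> z0 y0 r.
have -> : P z y = pi y * P y z / pi z by rewrite r; field; rewrite z0.
by field; rewrite z0 y0.
Qed.

Lemma density_mean x t :
  wmean predT pi (fun y => chain_law P x t y / pi y) = 1.
Proof.
elim: t => [|t IH].
  rewrite /wmean pi_sum1 divr1 (bigD1 x) //= eqxx big1 ?addr0 => [|y /negPf yx].
    by rewrite mul1r mulfV ?gt_eqF.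
  by rewrite yx mul0r mulr0.
rewrite -IH /wmean pi_sum1 !divr1 -[RHS]stationary_sum.
by apply: eq_bigr => y _; congr (_ * _); exact: chain_law_density.
Qed.

Lemma density_variance x t :
  wvar predT pi (fun y => chain_law P x t y / pi y) <=
  (1 - delta / kappa) ^+ t / pi x.
Proof.
elim: t => [|t IH].
  (* The initial density is [1 / pi x] at [x] and zero elsewhere, with second moment [1 / pi x]. *)
  apply: le_trans (wvar_le _ _ _ 0) _.
  - by move=> y _; exact: ltW.
  - by rewrite pi_sum1.
  rewrite (bigD1 x) //= eqxx big1 ?addr0 => [|y /negPf yx].
    rewrite subr0 expr0 mul1r expr2 mulrA mulfV ?gt_eqF // mul1r.
    exact: lexx.
  by rewrite yx mul0r subrr expr0n mulr0.
have -> : wvar predT pi (fun y => chain_law P x t.+1 y / pi y) =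
    wvar predT pi (chain_op (fun z => chain_law P x t z / pi z)).
  by congr wvar; apply: funext => y; exact: chain_law_density.
apply: le_trans (wvar_chain_op _) _; rewrite exprS -mulrA ler_wpM2l //.
by rewrite subr_ge0 ler_pdivrMr // mul1r.
Qed.

Lemma tv_dist_density mu :
  wmean predT pi (fun y => mu y / pi y) = 1 ->
  (2 * tv_dist mu pi) ^+ 2 <= wvar predT pi (fun y => mu y / pi y).
Proof.
move=> mean1; rewrite /tv_dist mulrA mulfV // mul1r /wvar mean1.
have -> : \sum_y `|mu y - pi y| = \sum_y pi y * `|mu y / pi y - 1|.
  apply: eq_bigr => y _; rewrite -[X in X * _]gtr0_norm // -normrM.
  by congr `| _ |; field; rewrite gt_eqF.
apply: le_trans (sum_CauchySchwarz _ _) _ => [y _|]; first exact: ltW.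
rewrite pi_sum1 mul1r le_eqVlt; apply/orP; left; apply/eqP.
by apply: eq_bigr => y _; rewrite real_normK // num_real.
Qed.

Lemma mixed_at_of_gap (eps : R) t : 0 < eps ->
  (forall x, (1 - delta / kappa) ^+ t < (2 * eps) ^+ 2 * pi x) ->
  mixed_at P pi eps t.
Proof.
move=> eps0 small x.
rewrite -(ltr_pM2l (_ : 0 < 2 :> R)) // -(@ltr_pXn2r _ 2) ?nnegrE //.
- apply: le_lt_trans (tv_dist_density (density_mean x t)) _.
  apply: le_lt_trans (density_variance x t) _.
  by rewrite ltr_pdivrMr.
- by rewrite /tv_dist !mulr_ge0 ?invr_ge0 ?sumr_ge0.
- by rewrite mulr_ge0 // ltW.
Qed.

End ReversibleChain.

(** * The Glauber dynamics *)

Section Glauber.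
Context {R : realType} (lam : R) (lam_gt0 : 0 < lam) (G : sgraph).
Implicit Types (S : indset G) (v : G).

Local Notation w := (@hc_weight R lam G).
Local Notation upd := (glauber_update lam).
Local Notation Z := (\sum_(S : indset G) lam ^+ #|S|).

Let lam1_gt0 : 0 < lam + 1. Proof. exact: addr_gt0. Qed.

Definition indset0 : indset G := IndSet (independent0 G).

Lemma independent_indset S : independent S.
Proof. exact: valP S. Qed.

(** Bridge between the state space of the chain and the sums over [{set G}] used for the Poincare
    inequality. *)
Lemma sum_indset (F : {set G} -> R) :
  \sum_(S : indset G) F S = \sum_(S | ind_in [set: G]%SET S) F S.
Proof.
rewrite (reindex_onto (@indset_val G) (insubd indset0)) /=; last first.
  by move=> S /andP[iS _]; exact: (insubdK indset0 iS).
apply: eq_bigl => S.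
by rewrite /ind_in finset.subsetT independent_indset (valKd indset0) eqxx.
Qed.

Lemma indset_partition_gt0 : 0 < Z.
Proof. by rewrite (sum_indset w); exact: hc_partition_gt0. Qed.

Lemma sum_indset_eq (X : {set G}) : independent X ->
  \sum_(S : indset G) (S == X :> {set G})%:R = 1 :> R.
Proof.
move=> iX; rewrite (bigD1 (IndSet iX)) //= eqxx big1 ?addr0 // => S.
by move=> SX; rewrite -[X]/(val (IndSet iX)) val_eqE (negPf SX).
Qed.

Lemma setU1_id v (X : {set G}) : v \in X -> v |: X = X.
Proof. by move=> vX; apply/finset.setUidPr; rewrite finset.sub1set. Qed.

Lemma setD1_id v (X : {set G}) : v \notin X -> X :\ v = X.
Proof.
by move=> vX; apply/finset.setDidPl; rewrite disjoint_sym disjoints1.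
Qed.

Lemma independent_setD1 S v : independent ((S : {set G}) :\ v).
Proof. exact: independentS (subD1set _ _) (independent_indset S). Qed.

Lemma glauber_update_ge0 v S S' : 0 <= upd v S S'.
Proof.
rewrite /glauber_update; case: ifP => // _.
by rewrite addr_ge0 // mulr_ge0 // divr_ge0 // ltW.
Qed.

Lemma glauber_update_sum1 v S : \sum_S' upd v S S' = 1.
Proof.
rewrite /glauber_update.
have [_|] := boolP ((v \notin (S : {set G})) && _).
  by rewrite (bigD1 S) //= eqxx big1 ?addr0 // => S' /negPf ->.
rewrite negb_and !negbK => vS.
have ivS : independent (v |: (S : {set G})).
  have [vS'|vS'] := boolP (v \in (S : {set G})).
    by rewrite setU1_id // independent_indset.
  by rewrite (negPf vS') in vS.
rewrite big_split -!mulr_sumr !sum_indset_eq ?independent_setD1 //.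
by rewrite !mulr1 /=; field; rewrite gt_eqF.
Qed.

Lemma glauber_update_insert v S S' :
  v \notin (S : {set G}) -> S' = v |: S :> {set G} ->
  [/\ w S' = lam * w S, upd v S S' = lam / (lam + 1)
    & upd v S' S = 1 / (lam + 1)].
Proof.
move=> vS E; have vS' : v \in (S' : {set G}) by rewrite E finset.setU11.
split.
- by rewrite /hc_weight E cardsU1 vS add1n exprS.
- rewrite /glauber_update -E independent_indset andbF eqxx mulr1.
  have -> : (S' == (S : {set G}) :\ v :> {set G}) = false.
    by apply: contraTF vS' => /eqP ->; rewrite setD11.
  by rewrite mulr0 addr0.
- rewrite /glauber_update vS' /= {2}E finset.setU1K // eqxx mulr1.
  have -> : (S == v |: (S' : {set G}) :> {set G}) = false.
    by apply: contraNF vS => /eqP ->; rewrite finset.setU11.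
  by rewrite mulr0 add0r.
Qed.

Lemma glauber_update_other v S S' : S != S' ->
  S' != v |: S :> {set G} -> S != v |: S' :> {set G} -> upd v S S' = 0.
Proof.
move=> SS' SvS' S'vS; rewrite /glauber_update eq_sym (negPf SS').
case: ifP => // _; rewrite (negPf SvS') mulr0 add0r.
have -> : (S' == (S : {set G}) :\ v :> {set G}) = false; last by rewrite mulr0.
have [vS|vS] := boolP (v \in (S : {set G})).
  by apply: contraNF S'vS => /eqP ->; rewrite finset.setD1K.
by rewrite setD1_id // -[RHS](negPf SS') eq_sym -val_eqE.
Qed.

(** Distinct states communicate at [v] only if one is the other plus [v]; with [S] the smaller, both
    sides are [w S * lam / (lam + 1)]. *)
Lemma glauber_update_reversible v S S' :
  w S * upd v S S' = w S' * upd v S' S.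
Proof.
have [->//|SS'] := eqVneq S S'.
have ne X Y : X != Y -> X = v |: Y :> {set G} -> v \notin (Y : {set G}).
  move=> XY E; apply: contraNN XY => vY.
  by rewrite -val_eqE /= E setU1_id.
have [E|SvS'] := eqVneq (S' : {set G}) (v |: S).
  have [|-> -> ->] := @glauber_update_insert v S S' _ E.
    by apply: (ne S') => //; rewrite eq_sym.
  ring.
have [E|S'vS] := eqVneq (S : {set G}) (v |: S').
  have [|-> -> ->] := @glauber_update_insert v S' S _ E; first exact: (ne S).
  ring.
by rewrite !glauber_update_other ?mulr0 // eq_sym.
Qed.

(** The holding probability is [1], [lam / (lam + 1)] or [1 / (lam + 1)]; the bound is the product
    of the last two. *)
Lemma glauber_update_lazy v S : lam / (lam + 1) ^+ 2 <= upd v S S.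
Proof.
have l0 := ltW lam_gt0.
have b1 : lam / (lam + 1) ^+ 2 <= lam / (lam + 1).
  rewrite ler_pM2l // lef_pV2 ?posrE ?exprn_gt0 //.
  by rewrite expr2 ler_peMl ?lerDr // ltW.
have b2 : lam / (lam + 1) ^+ 2 <= 1 / (lam + 1).
  by rewrite ler_pdivrMr ?exprn_gt0 // expr2 mulrA divfK ?gt_eqF // mul1r lerDl.
rewrite /glauber_update; case: ifP => [_|_].
  by rewrite eqxx (le_trans b1) // ler_pdivrMr // mul1r lerDl.
have [vS|vS] := boolP (v \in (S : {set G})).
  by rewrite setU1_id // eqxx mulr1 (le_trans b1) // lerDl mulr_ge0 // divr_ge0 // ltW.
by rewrite setD1_id // eqxx mulr1 (le_trans b2) // lerDr mulr_ge0 // divr_ge0 // ltW.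
Qed.

Lemma glauber_ge0 S S' : 0 <= glauber lam S S'.
Proof.
by apply: sumr_ge0 => v _; rewrite mulr_ge0 ?invr_ge0 // glauber_update_ge0.
Qed.

Lemma glauber_sum1 S : (0 < #|G|)%N -> \sum_S' glauber lam S S' = 1.
Proof.
move=> G0; rewrite /glauber exchange_big /=.
under eq_bigr do rewrite -mulr_sumr glauber_update_sum1 mulr1.
by rewrite sumr_const -[LHS]mulr_natr mulVf // pnatr_eq0 -lt0n.
Qed.

Lemma glauber_lazy S : (0 < #|G|)%N -> lam / (lam + 1) ^+ 2 <= glauber lam S S.
Proof.
move=> G0; rewrite /glauber -mulr_sumr ler_pdivlMl ?ltr0n //.
rewrite mulr_natl -sumr_const; apply: ler_sum => v _; exact: glauber_update_lazy.
Qed.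

Lemma hardcore_gt0 S : 0 < hardcore lam S.
Proof. by rewrite divr_gt0 ?exprn_gt0 // indset_partition_gt0. Qed.

Lemma hardcore_sum1 : \sum_(S : indset G) hardcore lam S = 1.
Proof. by rewrite -mulr_suml divff // gt_eqF // indset_partition_gt0. Qed.

Lemma glauber_reversible S S' :
  hardcore lam S * glauber lam S S' = hardcore lam S' * glauber lam S' S.
Proof.
rewrite /hardcore /glauber !mulr_sumr; apply: eq_bigr => v _.
have := glauber_update_reversible v S S'; rewrite /hc_weight => E.
have A (a b c d : R) : a / b * (c * d) = c / b * (a * d) by ring.
by rewrite A E [RHS]A.
Qed.

(** Only removals from [S] to [S :\ v] are kept. Each comes from selecting [v], with probability
    [1 / #|G|], then removing it, with probability [1 / (lam + 1)]; [Z] undoes the normalisation of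
    [hardcore]. *)
Lemma hc_form_le_glauber (F : {set G} -> R) : (0 < #|G|)%N ->
  hc_form lam [set: G]%SET F <= #|G|%:R * (lam + 1) * Z *
    \sum_(S : indset G) \sum_(S' : indset G)
       hardcore lam S * glauber lam S S' * (F S' - F S) ^+ 2.
Proof.
move=> G0; have Z0 := indset_partition_gt0.
have n0 : 0 < #|G|%:R :> R by rewrite ltr0n.
have -> : \sum_(S : indset G) \sum_(S' : indset G)
    hardcore lam S * glauber lam S S' * (F S' - F S) ^+ 2 =
  (Z * #|G|%:R)^-1 * \sum_v \sum_(S : indset G) \sum_(S' : indset G)
    w S * upd v S S' * (F S' - F S) ^+ 2.
  rewrite [in RHS]exchange_big mulr_sumr; apply: eq_bigr => S _ /=.
  rewrite [in RHS]exchange_big mulr_sumr; apply: eq_bigr => S' _ /=.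
  rewrite /glauber mulr_sumr mulr_suml mulr_sumr; apply: eq_bigr => v _.
  rewrite /hardcore invfM /hc_weight; ring.
have -> : #|G|%:R * (lam + 1) * Z * ((Z * #|G|%:R)^-1 *
    \sum_v \sum_(S : indset G) \sum_(S' : indset G)
    w S * upd v S S' * (F S' - F S) ^+ 2) =
    (lam + 1) * \sum_v \sum_(S : indset G) \sum_(S' : indset G)
    w S * upd v S S' * (F S' - F S) ^+ 2.
  by field; rewrite !gt_eqF.
rewrite /hc_form mulr_sumr big_mkcond; apply: ler_sum => v _; rewrite inE.
rewrite big_mkcondr -(sum_indset (fun S : {set G} => if v \in S then
  w S * (F S - F (S :\ v)) ^+ 2 else 0)) mulr_sumr.
apply: ler_sum => S _.
have ge0 S' : 0 <= w S * upd v S S' * (F S' - F S) ^+ 2.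
  by rewrite mulr_ge0 ?sqr_ge0 // mulr_ge0 ?hc_weight_ge0 ?glauber_update_ge0.
case: ifP => vS; last by rewrite mulr_ge0 ?(ltW lam1_gt0) // sumr_ge0.
pose S1 := IndSet (independent_setD1 S v).
have E : S = v |: (S1 : {set G}) :> {set G} by rewrite finset.setD1K.
have [|_ _ u] := glauber_update_insert _ E; first by rewrite setD11.
rewrite (bigD1 S1) //= u mulrDr.
rewrite ler_wpDr ?mulr_ge0 ?(ltW lam1_gt0) ?sumr_ge0 //.
rewrite le_eqVlt; apply/orP; left; apply/eqP.
by field; rewrite gt_eqF.
Qed.

Lemma glauber_gap (c : R) (f : indset G -> R) :
    (0 < #|G|)%N -> 0 <= c -> poincare lam c [set: G]%SET ->
  wvar predT (hardcore lam) f <= (c * (#|G|%:R * (lam + 1))) *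
    \sum_S \sum_S' hardcore lam S * glauber lam S S' * (f S' - f S) ^+ 2.
Proof.
move=> G0 c0 pc; have Z0 := indset_partition_gt0.
(* Extension by the default [f indset0] to dependent sets, which never enter the sums. *)
pose F X := f (insubd indset0 X).
have FE S : F S = f S by rewrite /F (valKd indset0).
set m := wmean (ind_in [set: G]%SET) w F.
apply: le_trans (wvar_le _ _ f m) _.
- by move=> S _; exact/ltW/hardcore_gt0.
- by rewrite hardcore_sum1.
have -> : \sum_S hardcore lam S * (f S - m) ^+ 2 =
    Z^-1 * wvar (ind_in [set: G]%SET) w F.
  rewrite /wvar -(sum_indset (fun X => w X * (F X - m) ^+ 2)) mulr_sumr.
  apply: eq_bigr => S _; rewrite FE /hardcore /hc_weight; ring.
have -> : \sum_S \sum_S' hardcore lam S * glauber lam S S' * (f S' - f S) ^+ 2 =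
    \sum_(S : indset G) \sum_(S' : indset G)
      hardcore lam S * glauber lam S S' * (F S' - F S) ^+ 2.
  by apply: eq_bigr => S _; apply: eq_bigr => S' _; rewrite !FE.
rewrite ler_pdivrMl //; apply: le_trans (pc F) _.
have := ler_wpM2l c0 (hc_form_le_glauber F G0).
by move/le_trans; apply; rewrite le_eqVlt; apply/orP; left; apply/eqP; ring.
Qed.

(** The partition function has at most [2 ^ #|G|] terms, each at most [(lam + 1) ^+ #|G|]. The
    numerator is bounded through [a = lam / (lam + 1)], which is below both [1] and [lam], so no
    case split on [lam] is needed. *)
Lemma hardcore_ge S :
  (lam / (2 * (lam + 1) ^+ 2)) ^+ #|G| <= hardcore lam S.
Proof.
have l0 := ltW lam_gt0.
rewrite ler_pdivlMr ?indset_partition_gt0 //.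
have -> : lam / (2 * (lam + 1) ^+ 2) = lam / (lam + 1) / (2 * (lam + 1)).
  by field; rewrite gt_eqF.
set a := lam / (lam + 1).
have a0 : 0 <= a by rewrite divr_ge0 // ltW.
have a1 : a <= 1 by rewrite ler_pdivrMr // mul1r lerDl.
have al : a <= lam by rewrite ler_pdivrMr // ler_peMr // lerDr.
have ZE : Z <= (2 * (lam + 1)) ^+ #|G|.
  apply: le_trans (_ : \sum_(S : {set G}) (lam + 1) ^+ #|G| <= _).
    rewrite (sum_indset w).
    apply: le_trans
      (_ : \sum_(S | ind_in [set: G]%SET S) (lam + 1) ^+ #|G| <= _).
      apply: ler_sum => X _; apply: le_trans (_ : (lam + 1) ^+ #|X| <= _).
        by rewrite lerXn2r ?nnegrE ?lerDl // ltW.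
      by rewrite ler_weXn2l ?lerDr ?max_card.
    by apply: ler_sum_sub => // X _; rewrite exprn_ge0 // ltW.
  have card_sets : #|{: {set G}}| = (2 ^ #|G|)%N.
    by rewrite -(cardsT G) -card_powerset powersetT cardsT.
  by rewrite sumr_const card_sets exprMn -[leLHS]mulr_natl natrX.
apply: le_trans (ler_wpM2l _ ZE) _.
  by rewrite exprn_ge0 // divr_ge0 // ltW // mulr_gt0.
rewrite -exprMn divfK ?gt_eqF ?mulr_gt0 //.
apply: le_trans (_ : a ^+ #|S| <= _).
  by rewrite ler_wiXn2l // max_card.
by rewrite lerXn2r ?nnegrE.
Qed.

End Glauber.

(** * Numerical estimates and the mixing time bound *)

Lemma bernoulli_ge (R : realDomainType) (x : R) n : 0 <= x ->
  1 + n%:R * x <= (1 + x) ^+ n.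
Proof.
move=> x0; elim: n => [|n IH]; first by rewrite mul0r addr0.
rewrite exprSr; apply: le_trans (_ : (1 + n%:R * x) * (1 + x) <= _).
  have : 0 <= n%:R * x * x by rewrite !mulr_ge0.
  rewrite -natr1; lra.
by rewrite ler_wpM2r // addr_ge0.
Qed.

(** Multiply by [(1 + e) ^+ s]: the product is at most [1], and the new factor is at least [2] by
    Bernoulli. *)
Lemma exprB_le_half (R : realFieldType) (e : R) s :
  0 <= e -> e <= 1 -> 1 <= s%:R * e -> (1 - e) ^+ s <= 2^-1.
Proof.
move=> e0 e1 se.
have : (1 - e) ^+ s * (1 + e) ^+ s <= 1.
  rewrite -exprMn exprn_ile1 //.
    by rewrite mulr_ge0 ?subr_ge0 // addr_ge0.
  by have := sqr_ge0 e; rewrite expr2; lra.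
have p0 : 0 <= (1 - e) ^+ s by rewrite exprn_ge0 // subr_ge0.
have b2 : 2 <= (1 + e) ^+ s by apply: le_trans (bernoulli_ge s e0); lra.
move/(le_trans (ler_wpM2l p0 b2)); lra.
Qed.

(** The time is a product of [s], a number of steps halving the variance bound, and [q * #|G| + 3]
    halvings, enough to beat the least stationary probability. A single power [2 ^+ q] dominates
    every constant depending on [lam]. *)
Lemma glauber_mixed_at (R : realType) (lam : R) (G T : sgraph)
    (B : T -> {set G}) (b q k : nat) :
  0 < lam -> (0 < #|G|)%N -> 2 * (lam + 1) ^+ 3 / lam <= 2 ^+ q ->
  is_tree_decomposition B -> (forall i, #|B i| <= b)%N -> (#|G| < 2 ^ k)%N ->
  mixed_at (@glauber R G lam) (hardcore lam) (1 / 4)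
    (2 ^ (q * (k * b) + q.+1) * #|G| * (q * #|G| + 3)).
Proof.
move=> lam0 G0 Kq tdB Bb Gk; have l0 := ltW lam0.
have lam1 : 0 < lam + 1 by rewrite addr_gt0.
have n1 : 1 <= #|G|%:R :> R by rewrite ler1n.
set c := 2 * (1 + 2 * lam) ^+ (k * b).
have pc : poincare lam c [set: G]%SET.
  by apply: (poincare_tree_decomposition lam0 tdB Bb); rewrite cardsT.
have c2 : 2 <= c.
  by rewrite -[leLHS]mulr1 ler_pM2l // exprn_ege1 // lerDl mulr_ge0.
have c_gt0 : 0 < c by apply: lt_le_trans c2.
set delta := lam / (lam + 1) ^+ 2.
set kappa := c * (#|G|%:R * (lam + 1)).
have delta0 : 0 < delta by rewrite divr_gt0 ?exprn_gt0.
have kappa0 : 0 < kappa by rewrite mulr_gt0 // mulr_gt0 // ltr0n.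
set s := (2 ^ (q * (k * b) + q.+1) * #|G|)%N.
have lq : 1 + 2 * lam <= 2 ^+ q.
  apply: le_trans Kq; rewrite ler_pdivlMr //.
  have := mulr_ge0 l0 l0; have : 0 <= lam ^+ 3 by rewrite exprn_ge0.
  rewrite !exprS !expr0 !mulr1; nra.
have ks : kappa / delta <= s%:R.
  have -> : kappa / delta = (1 + 2 * lam) ^+ (k * b) * #|G|%:R *
      (2 * (lam + 1) ^+ 3 / lam).
    by rewrite /kappa /delta /c; field; rewrite !gt_eqF.
  have -> : s%:R = (2 ^+ q) ^+ (k * b) * #|G|%:R * (2 * 2 ^+ q) :> R.
    by rewrite /s !natrM !natrX exprD exprM exprS; ring.
  apply: ler_pM.
  - by rewrite mulr_ge0 // exprn_ge0 // addr_ge0 // mulr_ge0.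
  - by rewrite divr_ge0 // mulr_ge0 // exprn_ge0 // ltW.
  - rewrite ler_wpM2r // lerXn2r ?nnegrE ?exprn_ge0 //.
    by rewrite addr_ge0 // mulr_ge0.
  - by apply: le_trans Kq _; rewrite ler_peMl ?exprn_ge0 // ler1n.
have delta1 : delta <= 1.
  rewrite ler_pdivrMr ?exprn_gt0 // mul1r expr2.
  have := mulr_ge0 l0 l0; lra.
have kappa1 : 1 <= kappa.
  by rewrite mulr_ege1 ?(le_trans _ c2) ?ler1n // mulr_ege1 // lerDr.
apply: (@mixed_at_of_gap R _ (glauber lam) (hardcore lam) delta kappa).
- exact: glauber_ge0.
- by move=> S; exact: glauber_sum1.
- exact: hardcore_gt0.
- exact: hardcore_sum1.
- exact: glauber_reversible.
- by move=> S; exact: glauber_lazy.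
- exact: ltW.
- exact: kappa0.
- exact: le_trans kappa1.
- by move=> f; apply: glauber_gap => //; exact: ltW.
- by rewrite divr_gt0.
move=> S; have dk1 : delta / kappa <= 1.
  by rewrite ler_pdivrMr // mul1r (le_trans delta1).
have half : (1 - delta / kappa) ^+ s <= 2^-1.
  apply: exprB_le_half => //; first by rewrite divr_ge0 ?ltW.
  by rewrite mulrA ler_pdivlMr // mul1r -ler_pdivrMr.
rewrite exprM; apply: le_lt_trans (_ : 2^-1 ^+ (q * #|G| + 3) < _).
  by rewrite lerXn2r ?nnegrE ?invr_ge0 ?exprn_ge0 ?subr_ge0.
have qpi : 2^-1 ^+ (q * #|G|) <= hardcore lam S.
  apply: le_trans (hardcore_ge lam0 S); rewrite exprM.
  rewrite lerXn2r ?nnegrE ?exprn_ge0 ?invr_ge0 ?divr_ge0 ?mulr_ge0 ?exprn_ge0 ?(ltW lam1) //.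
  rewrite exprVn -[leRHS]invrK lef_pV2 ?posrE ?invr_gt0 ?divr_gt0 ?mulr_gt0 ?exprn_gt0 //.
  apply: le_trans Kq; rewrite invf_div ler_pM2r ?invr_gt0 // ler_pM2l //.
  by rewrite ler_weXn2l // lerDr.
have pi0 := hardcore_gt0 lam0 S.
have r3 : 2^-1 ^+ 3 = 8^-1 :> R by rewrite exprVn -natrX.
(* The target is [(2 * (1 / 4)) ^+ 2 = 1 / 4] times [hardcore lam S]; the three extra halvings give
   [1 / 8], hence strictness. *)
rewrite exprD r3; have := qpi; rewrite expr2; lra.
Qed.

(** Since [2 ^ k <= 2 * n <= n ^ 2] and [t + 1 <= 2 * t], the four factors have exponents
    [4 * q * t], [q + 1], [1] and [q + 3] in base [n], and [t >= 1] absorbs their sum. *)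
Lemma mixing_steps_le (n t q : nat) : (2 <= n)%N -> (1 <= t)%N ->
  (2 ^ (q * ((trunc_log 2 n).+1 * t.+1) + q.+1) * n * (q * n + 3)
     <= n ^ ((6 * q + 5) * t))%N.
Proof.
move=> n2 t1; set k := (trunc_log 2 n).+1.
have n0 : (0 < n)%N by lia.
have mono m1 m2 e : (m1 <= m2 -> m1 ^ e <= m2 ^ e)%N.
  by case: e => // e; rewrite leq_exp2r.
have k_le : (2 ^ k <= n ^ 2)%N.
  by rewrite -mulnn expnS leq_mul // trunc_logP.
have e1 : (2 ^ (q * (k * t.+1)) <= n ^ (4 * q * t))%N.
  rewrite mulnCA expnM; apply: leq_trans (mono _ _ (q * t.+1)%N k_le) _.
  by rewrite -expnM leq_pexp2l //; nia.
have e2 : (2 ^ q.+1 <= n ^ q.+1)%N by rewrite leq_exp2r.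
have e3 : (q * n + 3 <= n ^ q.+3)%N.
  have nq : (q < n ^ q)%N.
    by apply: leq_trans (ltn_expl q (leqnn 2)) _; exact: mono.
  apply: leq_trans (_ : q.+1 * n * 4 <= _)%N; first by lia.
  have -> : (n ^ q.+3 = n ^ q * n * (n * n))%N by rewrite !expnSr !mulnA.
  by rewrite !leq_mul // (@leq_mul 2 2).
apply: leq_trans (_ : n ^ (4 * q * t) * n ^ q.+1 * n * n ^ q.+3 <= _)%N.
  by rewrite expnD !leq_mul.
rewrite -!expnD -expnSr -expnD leq_pexp2l //; nia.
Qed.

Theorem theorem1 (R : realType) (lam : R) (lam_gt0 : 0 < lam) :
  exists C : R, 0 < C /\
    forall (t : nat) (G : sgraph),
      (1 <= t)%N -> (2 <= #|G|)%N -> (treewidth G <= t)%N ->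
      (mixing_time (@glauber R G lam) (@hardcore R G lam) (1 / 4)
         <= ((#|G|%:R : R) `^ (C * t%:R))%:E)%E.
Proof.
have [q Kq] : exists q : nat, 2 * (lam + 1) ^+ 3 / lam <= 2 ^+ q.
  set K := _ / _; have K0 : 0 <= K.
    by rewrite divr_ge0 ?mulr_ge0 ?exprn_ge0 ?addr_ge0 // ltW.
  exists (Num.bound K); apply: ltW; apply: lt_le_trans (archi_boundP K0) _.
  by rewrite -natrX ler_nat ltnW // ltn_expl.
exists (6 * q + 5)%:R; split; first by rewrite ltr0n addn_gt0 orbT.
move=> t G t1 n2; rewrite /treewidth.
case: ex_minnP => w /asboolP[T [B [tdB wB]]] _ wt.
(* Width is the largest bag size minus one; truncation at zero only helps here. *)
have Bb i : (#|B i| <= t.+1)%N.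
  have := leq_bigmax (F := fun i => #|B i|) i.
  rewrite /td_width in wB; lia.
have n0 : (0 < #|G|)%N by apply: leq_trans n2.
have mixed := glauber_mixed_at lam_gt0 n0 Kq tdB Bb (trunc_log_ltn #|G| (leqnn 2)).
(* The mixing time is an infimum, so one time at which the chain is mixed bounds it. *)
apply: le_trans (ereal_inf_lbound (ex_intro2 _ _ _ mixed erefl)) _.
rewrite lee_fin -natrM powR_mulrn // -natrX ler_nat.
exact: mixing_steps_le.
Qed.
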